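(* Let $X,Y,Z$ be pointed metric spaces, let $0<p\le s\le\infty$ and let $\tilde r\in(0,\infty]$ satisfy $\frac1p=\frac1s+\frac1{\tilde r}\le1$. If $S\in\Pi^L_{(\mathfrak{m}^L(s;p),p)}(X,Y)$, $T\in\Pi^L_{(s,\mathfrak{m}^L(s;s))}(Y,Z)$ and $$\pi^L_{(\mathfrak{m}^L(s;p),p)}(S)\le\pi^L_{(\tilde r,\mathfrak{m}^L(\tilde r;\tilde r))}(S),$$ then $T\circ S\in\Pi^L_{(p,\mathfrak{m}^L(p;p))}(X,Z)$. Moreover $$\pi^L_{(p,\mathfrak{m}^L(p;p))}(T\circ S)\le\pi^L_{(s,\mathfrak{m}^L(s;s))}(T)\cdot\pi^L_{(\tilde r,\mathfrak{m}^L(\tilde r;\tilde r))}(S).$$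
   Context: For a metric space $X$ with base point $x_0$, $X^{\#}$ is the Banach space of real-valued Lipschitz functions on $X$ vanishing at $x_0$, with norm $Lip(\cdot)$ (the Lipschitz constant); $B_{X^{\#}}$ is its closed unit ball. $(\sigma,x',x'')$ denotes a finite sequence $(\sigma_j,x'_j,x''_j)_{j=1}^m$ in $\mathbb{R}\times X\times X$. Indices lie in $(0,\infty]$, $1/\infty=0$. Put $\|(\sigma,x',x'')|\ell_p\|=\big[\sum_j|\sigma_j|^p d_X(x'_j,x''_j)^p\big]^{1/p}$ and $\|(\sigma,x',x'')|\ell_p^{L,w}\|=\sup_{f\in B_{X^{\#}}}\big[\sum_j|\sigma_j|^p|f(x'_j)-f(x''_j)|^p\big]^{1/p}$ (sums replaced by suprema over $j$ if $p=\infty$). For $0<q\le s\le\infty$ let $s'(q)\in(0,\infty]$ be given by $\frac1{s'(q)}+\frac1s=\frac1q$, and put $\mathfrak{m}^L_{(s;q)}(\sigma,x',x'')=\inf_\tau\|\tau|\ell_{s'(q)}\|\,\|(\sigma/\tau,x',x'')|\ell_s^{L,w}\|$, the infimum over all $\tau=(\tau_j)$ with $\tau_j\in\mathbb{R}\setminus\{0\}$, where $\sigma/\tau=(\sigma_j/\tau_j)_j$. For $p\le q\le s$, a Lipschitz map $T:X\to Y$ is Lipschitz $(\mathfrak{m}^L(s;q),p)$-summing if there is $C\ge0$ with $\mathfrak{m}^L_{(s;q)}(\sigma,Tx',Tx'')\le C\,\|(\sigma,x',x'')|\ell_p^{L,w}\|$ for all finite sequences $(\sigma,x',x'')$; $\Pi^L_{(\mathfrak{m}^L(s;q),p)}(X,Y)$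 is the class of all such maps and $\pi^L_{(\mathfrak{m}^L(s;q),p)}(T)$ is the infimum of such $C$. For $0<p\le\infty$, a Lipschitz map $T:X\to Y$ is Lipschitz $(p,\mathfrak{m}^L(p;p))$-summing if there is $C\ge0$ with $\|(\sigma,Tx',Tx'')|\ell_p\|\le C\,\|(\sigma,x',x'')|\ell_p^{L,w}\|$ for all finite sequences; $\Pi^L_{(p,\mathfrak{m}^L(p;p))}(X,Y)$ is the class of all such maps and $\pi^L_{(p,\mathfrak{m}^L(p;p))}(T)$ is the infimum of such $C$. The infimum of the empty set is $\infty$. *)

(* Defs.v *)
From HB Require Import structures.
From mathcomp Require Import all_boot all_order all_algebra.
From mathcomp Require Import all_classical all_reals all_analysis.

Set Implicit Arguments.
Unset Strict Implicit.
Unset Printing Implicit Defensive.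

Import Order.TTheory GRing.Theory Num.Theory.
Import numFieldNormedType.Exports.

Local Open Scope classical_set_scope.
Local Open Scope ring_scope.

(* Indices in (0, +oo] are elements of \bar R; 1/p is (p^-1)%E, for which
   +oo^-1 = 0 and 0^-1 = +oo.  Pointed metric spaces are metric spaces X
   together with an explicit base point x0 : X.  A finite sequence
   (sigma, x', x'') of length m is given by three functions on 'I_m. *)

Section Lipschitz.
Context {R : realType}.

Definition lip_bound (X Y : metricType R) (f : X -> Y) : set R :=
  [set K | 0 <= K /\ forall x y, mdist (f x) (f y) <= K * mdist x y].

Definition is_lipschitz (X Y : metricType R) (f : X -> Y) : Prop :=
  lip_bound f !=set0.

Definition lip_const (X Y : metricType R) (f : X -> Y) : \bar R :=
  ereal_inf [set K%:E | K in lip_bound f].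

(* R^o is R with its usual distance mdist a b = `|b - a|. *)
Definition lip_unit_ball (X : metricType R) (x0 : X) : set (X -> R^o) :=
  [set f : X -> R^o | [/\ is_lipschitz f, f x0 = 0 & (lip_const f <= 1)%E]].

End Lipschitz.

Section Norms.
Context {R : realType}.

(* Only used for 0 < p; the value at -oo is junk. *)
Definition lp_norm (p : \bar R) m (a : 'I_m -> R) : R :=
  match p with
  | r%:E => (\sum_(j < m) `|a j| `^ r) `^ r^-1
  | +oo%E => \big[Num.max/0]_(j < m) `|a j|
  | -oo%E => 0
  end.

Definition strong_norm (p : \bar R) (X : metricType R) m
    (sigma : 'I_m -> R) (x' x'' : 'I_m -> X) : R :=
  lp_norm p (fun j => `|sigma j| * mdist (x' j) (x'' j)).

Definition weak_norm (p : \bar R) (X : metricType R) (x0 : X) m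
    (sigma : 'I_m -> R) (x' x'' : 'I_m -> X) : \bar R :=
  ereal_sup [set (lp_norm p (fun j => `|sigma j| * `|f (x' j) - f (x'' j)|))%:E
            | f in lip_unit_ball x0].

(* The index s'(q) with 1/s'(q) + 1/s = 1/q, for 0 < q <= s <= +oo. *)
Definition compl_index (s q : \bar R) : \bar R := ((q^-1 - s^-1)^-1)%E.

Definition mixed_norm (s q : \bar R) (X : metricType R) (x0 : X) m
    (sigma : 'I_m -> R) (x' x'' : 'I_m -> X) : \bar R :=
  ereal_inf [set ((lp_norm (compl_index s q) tau)%:E
                  * weak_norm s x0 (fun j => (sigma j / tau j)%R) x' x'')%E
            | tau in [set tau : 'I_m -> R | forall j, tau j != 0]].

End Norms.

Section Summing.
Context {R : realType}.

(* The class Pi^L_(m^L(s;q), p)(X, Y) and the quantity pi^L_(m^L(s;q), p). *)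
Definition mixed_summing_const (s q p : \bar R) (X Y : metricType R)
    (x0 : X) (y0 : Y) (T : X -> Y) : set R :=
  [set C | 0 <= C /\
    forall m (sigma : 'I_m -> R) (x' x'' : 'I_m -> X),
      (mixed_norm s q y0 sigma (T \o x') (T \o x'')
       <= C%:E * weak_norm p x0 sigma x' x'')%E].

Definition mixed_summing (s q p : \bar R) (X Y : metricType R)
    (x0 : X) (y0 : Y) (T : X -> Y) : Prop :=
  is_lipschitz T /\ mixed_summing_const s q p x0 y0 T !=set0.

Definition mixed_summing_norm (s q p : \bar R) (X Y : metricType R)
    (x0 : X) (y0 : Y) (T : X -> Y) : \bar R :=
  ereal_inf [set C%:E | C in mixed_summing_const s q p x0 y0 T].

(* The class Pi^L_(p, m^L(p;p))(X, Y) and the quantity pi^L_(p, m^L(p;p)). *)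
Definition summing_const (p : \bar R) (X Y : metricType R)
    (x0 : X) (T : X -> Y) : set R :=
  [set C | 0 <= C /\
    forall m (sigma : 'I_m -> R) (x' x'' : 'I_m -> X),
      ((strong_norm p sigma (T \o x') (T \o x''))%:E
       <= C%:E * weak_norm p x0 sigma x' x'')%E].

Definition summing (p : \bar R) (X Y : metricType R)
    (x0 : X) (T : X -> Y) : Prop :=
  is_lipschitz T /\ summing_const p x0 T !=set0.

Definition summing_norm (p : \bar R) (X Y : metricType R)
    (x0 : X) (T : X -> Y) : \bar R :=
  ereal_inf [set C%:E | C in summing_const p x0 T].

End Summing.

(* Main.v *)
Require Import Defs.
From HB Require Import structures.
From mathcomp Require Import all_boot all_order all_algebra.
From mathcomp Require Import all_classical all_reals all_analysis.
Import Order.TTheory GRing.Theory Num.Theory.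
Import numFieldNormedType.Exports.
Local Open Scope classical_set_scope.
Local Open Scope ring_scope.

(** The theorem is a factorization through mixed sequences.  Given nonzero
weights tau, write sigma_j d(TSx'_j, TSx''_j) as the product of tau_j and
(sigma_j / tau_j) d(TSx'_j, TSx''_j).  Hoelder's inequality for the exponents
1/p = 1/r + 1/s bounds its l_p norm by the l_r norm of tau times an l_s norm,
and since T is s-summing with constant D the latter is at most D times the weak
l_s norm of (sigma/tau, Sx', Sx'').  As r is exactly the index that occurs in
the mixed quantity m(s;p), the infimum over tau turns this into
D m(s;p)(sigma, Sx', Sx'') ([summing_const_mixed_norm]), which the summing
property of S with constant C bounds by D C times the weak l_p norm of
(sigma, x', x'').

So every product D C of admissible constants is admissible for the composition
([summing_const_comp]).  Taking infima over C and D bounds the norm of the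
composition by the product of the norm of T and the mixed norm of S, and the
comparison assumed for the two norms of S finishes the proof.  The norm of S on
the right of the conclusion may be infinite while that of T is zero, so the
passage to infima is made in the extended reals, with 0 * oo = 0
([le_mule_ereal_inf]). *)

(** Induction on the index sequence reduces the inequality to two terms: the
partial sums A, B enter [hoelder2] as the second pair of entries, A^(1/u) and
B^(1/v). *)
Lemma hoelder_sum (R : realType) (I : Type) (l : seq I) (a b : I -> R)
    (u v : R) :
  (forall i, 0 <= a i) -> (forall i, 0 <= b i) ->
  0 < u -> 0 < v -> u^-1 + v^-1 = 1 ->
  \sum_(i <- l) a i * b i <=
    (\sum_(i <- l) a i `^ u) `^ u^-1 * (\sum_(i <- l) b i `^ v) `^ v^-1.
Proof.
move=> a_ge0 b_ge0 u_gt0 v_gt0 uv1.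
elim: l => [|i l IHl].
  by rewrite big_nil mulr_ge0// powR_ge0.
rewrite !big_cons.
set A := \sum_(j <- l) a j `^ u; set B := \sum_(j <- l) b j `^ v.
have A_ge0 : 0 <= A by apply: sumr_ge0 => *; exact: powR_ge0.
have B_ge0 : 0 <= B by apply: sumr_ge0 => *; exact: powR_ge0.
apply: (@le_trans _ _ (a i * b i + A `^ u^-1 * B `^ v^-1)).
  by rewrite lerD2l.
have := @hoelder2 R (a i) (A `^ u^-1) (b i) (B `^ v^-1) u v
  (a_ge0 i) (powR_ge0 _ _) (b_ge0 i) (powR_ge0 _ _) u_gt0 v_gt0 uv1.
by rewrite -!powRrM !mulVf ?gt_eqF// !powRr1.
Qed.

Section LpNorm.
Context {R : realType}.
Implicit Types p s t : \bar R.

Lemma lp_norm_ge0 p m (a : 'I_m -> R) : 0 <= lp_norm p a.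
Proof.
case: p => [r| |] //=; first exact: powR_ge0.
exact: bigmax_ge_id.
Qed.

Lemma eq_lp_norm p m (a b : 'I_m -> R) :
  (forall j, `|a j| = `|b j|) -> lp_norm p a = lp_norm p b.
Proof.
move=> ab; case: p => [r| |] //=; last by under eq_bigr do rewrite ab.
by congr (_ `^ _); apply: eq_bigr => j _; rewrite ab.
Qed.

(** This is [hoelder_sum] applied to the p-th powers of the entries, with the
conjugate exponents t/p and s/p; p may be smaller than 1. *)
Lemma lp_norm_mul_fin (p t s : R) m (a b : 'I_m -> R) :
  0 < p -> 0 < t -> 0 < s -> p^-1 = t^-1 + s^-1 ->
  lp_norm p%:E (fun j => a j * b j) <= lp_norm t%:E a * lp_norm s%:E b.
Proof.
move=> p_gt0 t_gt0 s_gt0 pts /=.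
have pn0 : p != 0 by rewrite gt_eqF.
have tp_gt0 : 0 < t / p by rewrite divr_gt0.
have sp_gt0 : 0 < s / p by rewrite divr_gt0.
have conj : (t / p)^-1 + (s / p)^-1 = 1.
  by rewrite !invf_div -mulrDr -pts divff.
have powK (q : R) (c : 'I_m -> R) :
    \sum_j (`|c j| `^ p) `^ (q / p) = \sum_j `|c j| `^ q.
  by apply: eq_bigr => j _; rewrite -powRrM mulrCA divff// mulr1.
have := @hoelder_sum R _ (index_enum 'I_m) (fun j => `|a j| `^ p)
  (fun j => `|b j| `^ p) _ _ (fun=> powR_ge0 _ _) (fun=> powR_ge0 _ _)
  tp_gt0 sp_gt0 conj.
rewrite !powK => H.
under eq_bigr do rewrite normrM powRM//.
have expE (q : R) : (q / p)^-1 / p = q^-1.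
  by rewrite invf_div mulrAC divff// mul1r.
rewrite -(expE t) -(expE s) !powRrM -powRM ?powR_ge0//.
apply: ge0_ler_powR => //; first by rewrite invr_ge0 ltW.
- by rewrite nnegrE sumr_ge0// => j _; rewrite mulr_ge0 ?powR_ge0.
- by rewrite nnegrE mulr_ge0 ?powR_ge0.
Qed.

Lemma lp_norm_mul_pinfty p m (a b : 'I_m -> R) : (0 < p)%E ->
  lp_norm p (fun j => a j * b j) <= lp_norm p a * lp_norm +oo%E b.
Proof.
have b_le j : `|b j| <= lp_norm +oo%E b := le_bigmax _ _ j.
have M_ge0 : 0 <= lp_norm +oo%E b := lp_norm_ge0 _ _ _.
set M := lp_norm +oo%E b in b_le M_ge0 *.
case: p => [p| |] //; last first.
  move=> _ /=; apply: bigmax_le => [|j _]; first by rewrite mulr_ge0 ?bigmax_ge_id.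
  by rewrite normrM ler_pM// le_bigmax.
rewrite lte_fin => p_gt0 /=.
have pn0 : p != 0 by rewrite gt_eqF.
have -> : M = (M `^ p) `^ p^-1 by rewrite -powRrM divff// powRr1.
rewrite -powRM ?powR_ge0//; last by rewrite sumr_ge0// => *; exact: powR_ge0.
apply: ge0_ler_powR; first by rewrite invr_ge0 ltW.
- by rewrite nnegrE sumr_ge0// => *; exact: powR_ge0.
- by rewrite nnegrE mulr_ge0 ?powR_ge0// sumr_ge0// => *; exact: powR_ge0.
rewrite mulr_suml; apply: ler_sum => j _.
rewrite normrM powRM// ler_wpM2l ?powR_ge0//.
by apply: ge0_ler_powR; rewrite ?nnegrE// ltW.
Qed.

(** When p is infinite both s and t are, and when exactly one of s and t is
infinite the other one equals p; these degenerate cases only need the maximum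
of one factor to be pulled out. *)
Lemma lp_norm_mul p s t m (a b : 'I_m -> R) :
  (0 < p)%E -> (0 < s)%E -> (0 < t)%E -> (p^-1 = s^-1 + t^-1)%E ->
  lp_norm p (fun j => a j * b j) <= lp_norm t a * lp_norm s b.
Proof.
move=> p_gt0 + t_gt0; case: s => [s| |] // s_gt0.
  case: t t_gt0 => [t| |] // t_gt0; last first.
    rewrite invey adde0 => /(inv_inj inveK) ->.
    rewrite mulrC (@eq_lp_norm _ _ _ (fun j => b j * a j)).
      exact: lp_norm_mul_pinfty.
    by move=> j; rewrite mulrC.
  rewrite !lte_fin in s_gt0 t_gt0.
  case: p p_gt0 => [p| |] // p_gt0.
    rewrite lte_fin in p_gt0.
    rewrite !inver !gt_eqF// => -[pst].
    by apply: lp_norm_mul_fin => //; rewrite addrC.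
  rewrite invey !inver !gt_eqF// => -[] /eqP.
  by rewrite eq_sym gt_eqF// addr_gt0// invr_gt0.
by rewrite invey add0e => /(inv_inj inveK) <-; exact: lp_norm_mul_pinfty.
Qed.

End LpNorm.

Local Open Scope ereal_scope.

(** For c > 0 scaling commutes with the infimum.  For c = 0 both products are 0,
even at infinity, and any element of A gives x <= 0: this is why A has to be
nonempty. *)
Lemma le_mule_ereal_inf (R : realType) (A : set \bar R) (c x : \bar R) :
  A !=set0 -> 0 <= c -> c \is a fin_num -> (forall y, A y -> x <= c * y) ->
  x <= c * ereal_inf A.
Proof.
move=> [y0 Ay0] + /fineK; case: c => [c| |]// + _ xle.
rewrite lee_fin le_eqVlt => /predU1P[c0|c_gt0].
  by have := xle _ Ay0; rewrite -c0 !mul0e.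
rewrite -ereal_inf_pZl//; apply: le_ereal_inf_tmp => _ [y Ay <-].
exact: xle.
Qed.

Section Factorization.
Context {R : realType}.

Lemma is_lipschitz_comp (X Y Z : metricType R) (S : X -> Y) (T : Y -> Z) :
  is_lipschitz S -> is_lipschitz T -> is_lipschitz (T \o S).
Proof.
move=> [K [K_ge0 SK]] [L [L_ge0 TL]]; exists (L * K)%R.
split=> [|x y]; first exact: mulr_ge0.
by rewrite -mulrA (le_trans (TL _ _))// ler_wpM2l.
Qed.

(** Positivity of s keeps s^-1 finite, so that it cancels even when r^-1 is
zero, that is when s = p and r is infinite. *)
Lemma compl_indexE (p s r : \bar R) :
  0 < s -> p^-1 = s^-1 + r^-1 -> compl_index s p = r.
Proof.
move=> s_gt0 psr; rewrite /compl_index psr addeAC subee ?add0e ?inveK//.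
by rewrite fin_numV ?gt_eqF// (lt_trans _ s_gt0).
Qed.

(** The step where Hoelder's inequality meets the definition of the mixed
quantity: each weight tau gives one upper bound, and the mixed quantity is the
infimum of these bounds up to the factor D. *)
Lemma summing_const_mixed_norm (p s r : \bar R) (Y Z : metricType R) (y0 : Y)
    (T : Y -> Z) (D : R) m (sigma : 'I_m -> R) (y' y'' : 'I_m -> Y) :
  0 < p -> 0 < s -> 0 < r -> p^-1 = s^-1 + r^-1 ->
  summing_const s y0 T D ->
  (strong_norm p sigma (T \o y') (T \o y''))%:E <=
    D%:E * mixed_norm s p y0 sigma y' y''.
Proof.
move=> p_gt0 s_gt0 r_gt0 psr [D_ge0 TD].
apply: le_mule_ereal_inf => //.
  (* Constant weights 1 show that the infimum is over a nonempty set. *)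
  by eexists; exists (fun=> 1%R) => // j; rewrite /= oner_eq0.
move=> _ [tau tau_neq0 <-]; rewrite (compl_indexE _ _ _ s_gt0 psr).
rewrite muleCA.
have normE : strong_norm p sigma (T \o y') (T \o y'') =
    lp_norm p (fun j => tau j *
      (`|sigma j / tau j| * mdist (T (y' j)) (T (y'' j))))%R.
  apply: eq_lp_norm => j /=.
  rewrite !normrM !normr_id normfV mulrA.
  by rewrite [(`|tau j| * _)%R]mulrC divfK// normr_eq0 tau_neq0.
apply: (@le_trans _ _ ((lp_norm r tau)%:E *
    (strong_norm s (fun j => sigma j / tau j)%R (T \o y') (T \o y''))%:E)).
  by rewrite normE -EFinM lee_fin lp_norm_mul.
by rewrite lee_wpmul2l ?lee_fin ?lp_norm_ge0.
Qed.

Lemma summing_const_comp (p s r : \bar R) (X Y Z : metricType R)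
    (x0 : X) (y0 : Y) (S : X -> Y) (T : Y -> Z) (C D : R) :
  0 < p -> 0 < s -> 0 < r -> p^-1 = s^-1 + r^-1 ->
  mixed_summing_const s p p x0 y0 S C -> summing_const s y0 T D ->
  summing_const p x0 (T \o S) (D * C)%R.
Proof.
move=> p_gt0 s_gt0 r_gt0 psr [C_ge0 SC] TD.
have D_ge0 : (0 <= D)%R by case: TD.
split=> [|m sigma x' x'']; first exact: mulr_ge0.
apply: le_trans (@summing_const_mixed_norm p s r Y Z y0 T D m sigma
  (S \o x') (S \o x'') p_gt0 s_gt0 r_gt0 psr TD) _.
by rewrite EFinM -muleA lee_wpmul2l ?lee_fin.
Qed.

End Factorization.

Theorem theorem7p1 (R : realType) (X Y Z : metricType R)
    (x0 : X) (y0 : Y) (z0 : Z) (p s r : \bar R)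
    (p_gt0 : 0 < p) (p_le_s : p <= s) (r_gt0 : 0 < r)
    (psr : p^-1 = s^-1 + r^-1) (p_inv_le1 : p^-1 <= 1)
    (S : X -> Y) (T : Y -> Z)
    (hS : mixed_summing s p p x0 y0 S)
    (hT : summing s y0 T)
    (hSr : mixed_summing_norm s p p x0 y0 S <= summing_norm r x0 S) :
  summing p x0 (T \o S) /\
  summing_norm p x0 (T \o S) <= summing_norm s y0 T * summing_norm r x0 S.
Proof.
have s_gt0 : 0 < s := lt_le_trans p_gt0 p_le_s.
have [Slip [C SC]] := hS; have [Tlip [D TD]] := hT.
have comp_const C' D' := @summing_const_comp R p s r X Y Z x0 y0 S T C' D'
  p_gt0 s_gt0 r_gt0 psr.
split.
  by split; [exact: is_lipschitz_comp|exists (D * C)%R; exact: comp_const].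
have T_ge0 : 0 <= summing_norm s y0 T.
  by apply: le_ereal_inf_tmp => _ [D' [D'_ge0 _] <-]; rewrite lee_fin.
have T_fin : summing_norm s y0 T \is a fin_num.
  rewrite ge0_fin_numE//; apply: le_lt_trans (ltry D).
  by apply: ereal_inf_lbound; exists D.
apply: le_trans (lee_wpmul2l T_ge0 hSr).
apply: le_mule_ereal_inf => //; first by exists C%:E, C.
move=> _ [C' SC' <-]; rewrite muleC.
have C'_ge0 : (0 <= C')%R by case: SC'.
apply: le_mule_ereal_inf => //; first by exists D%:E, D.
move=> _ [D' TD' <-]; rewrite muleC -EFinM.
by apply: ereal_inf_lbound; exists (D' * C')%R => //; exact: comp_const.
Qed.
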